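(* Let $n>1$ be an integer and let $f$ be drawn uniformly at random from $\mathcal{L}_n$. Then \[ \mathbb{E}\big(\|f\|_4^4\big)=2n^2-n,\qquad {\rm Var}\big(\|f\|_4^4\big)=\frac{16}{3}n^3-20n^2+\frac{56}{3}n-2+2(-1)^n . \]
   Context: For a polynomial $f\in\mathbb{C}[z]$ and real $p>0$, $\|f\|_p=\big(\frac{1}{2\pi}\int_0^{2\pi}|f(e^{i\theta})|^p\,d\theta\big)^{1/p}$. For an integer $n>1$, $\mathcal{L}_n$ denotes the set of Littlewood polynomials of degree $n-1$, i.e. polynomials $\sum_{j=0}^{n-1}a_jz^j$ with all $a_j\in\{1,-1\}$. *)

(* Defs.v *)
From HB Require Import structures.
From mathcomp Require Import all_boot all_order all_algebra finmap.
From mathcomp Require Import all_classical all_reals all_analysis.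
From mathcomp.real_closed Require Import complex.

Set Implicit Arguments.
Unset Strict Implicit.
Unset Printing Implicit Defensive.

Import Order.TTheory GRing.Theory Num.Theory.
Import numFieldNormedType.Exports.

Local Open Scope classical_set_scope.
Local Open Scope ring_scope.
Local Open Scope complex_scope.

Definition expi {R : realType} (t : R) : R[i] := cos t +i* sin t.

(* Meaningful for 0 < p.  [normc] is the real-valued complex modulus and
   [a `^ p] the real power, with [0 `^ p = 0] for p != 0. *)
Definition polynorm {R : realType} (p : R) (f : {poly R[i]}) : R :=
  ((2 * pi)^-1 *
     \int[lebesgue_measure]_(t in `[0, 2 * pi])
        (ComplexField.Normc.normc f.[expi t] `^ p)) `^ p^-1.

(* [size f = n] says that f has degree n - 1 (for 0 < n). *)
Definition littlewood {R : realType} (n : nat) : set {poly R[i]} :=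
  [set f : {poly R[i]} |
    size f = n /\ forall j : nat, (j < n)%N -> f`_j = 1 \/ f`_j = -1].

(* The law of the random element f is uniform on the set A, meaningful only
   for finite A (the cardinal below is 0 when A is infinite).  The type X
   carries no sigma-algebra, so measurability of f is required fibrewise. *)
Definition uniform_on {d : measure_display} {T : measurableType d}
    {R : realType} (P : probability T R) {X : choiceType}
    (A : set X) (f : T -> X) : Prop :=
  (forall w, A (f w)) /\
  forall g, A g ->
    measurable (f @^-1` [set g]) /\
    P (f @^-1` [set g]) = ((#|` fset_set A|%:R : R)^-1)%:E.

(* Main.v *)
(** Expanding |f|^4 on the unit circle and integrating the resulting cosine
    polynomial gives ||f||_4^4 = sum of a_j a_k a_l a_m over j + k = l + m.
    The quadruples with {j,k} = {l,m} contribute the constant 2n^2 - n.  The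
    others are grouped by the indices p < q <= r < s with p + s = q + r that
    occur: 8 a_p a_q a_r a_s if q < r, and 4 a_p a_s if q = r.  These monomials
    are distinct nontrivial Walsh characters in the signs, hence have mean 0
    and are orthonormal, so the variance is 64 times the number of
    p < q < r < s plus 16 times the number of p < q = r < s. *)

Require Import Defs.
From HB Require Import structures.
From mathcomp Require Import all_boot all_order all_algebra finmap.
From mathcomp Require Import all_classical all_reals all_analysis.
From mathcomp.real_closed Require Import complex.
From mathcomp Require Import ring lra zify.

Import Order.TTheory GRing.Theory Num.Theory.
Import numFieldNormedType.Exports.

Local Open Scope classical_set_scope.
Local Open Scope ring_scope.

(** * Integrals of cosine sums over a full period *)

Lemma sin_natr_2pi (R : realType) (k : nat) : sin (k%:R * (2 * pi)) = 0 :> R.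
Proof.
elim: k => [|k IH]; first by rewrite mul0r sin0.
by rewrite -natr1 mulrDl mul1r [2 * pi]mulr_natl sinD2pi -[pi *+ 2]mulr_natl.
Qed.

(** A term of nonzero frequency has an antiderivative that vanishes at both endpoints; a term of
    frequency zero integrates to [2 * pi] times its coefficient. Frequencies are kept as differences
    of naturals so that the sine subtraction formula reduces the value at [2 * pi] to
    [sin_natr_2pi]. *)
Lemma Rintegral_trig_sum (R : realType) (I : finType) (c : I -> R)
    (u v : I -> nat) :
  \int[lebesgue_measure]_(t in `[0, 2 * pi])
     (\sum_i c i * cos (((u i)%:R - (v i)%:R) * t)) =
  2 * pi * \sum_(i | u i == v i) c i.
Proof.
have pi2_gt0 : 0 < 2 * pi :> R by rewrite mulr_gt0 // pi_gt0.
pose w i : R := (u i)%:R - (v i)%:R.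
pose g i (t : R) : R := if u i == v i then t else sin (w i * t) / w i.
have gE i (x : R) : is_derive x 1 (g i) (cos (w i * x)).
  rewrite /g; case: eqP => [uv|/eqP uv].
    by rewrite /w uv subrr mul0r cos0; exact: is_derive_id.
  have w0 : w i != 0 by rewrite subr_eq0 eqr_nat.
  apply: is_derive_eq.
  rewrite /GRing.scale /=; field; exact: w0.
pose G (t : R) : R := \sum_i c i *: g i t.
have GE (x : R) : is_derive x 1 G (\sum_i c i * cos (w i * x)).
  have -> : G = \sum_i (fun t => c i *: g i t) by apply/funext => t; rewrite fct_sumE.
  elim/big_ind2: _ => [|f df h dh fE hE|i _]; first exact: is_derive_cst.
    exact: is_deriveD.
  exact: is_deriveZ.
have Gc : continuous G.
  by move=> x; apply: differentiable_continuous; apply/derivable1_diffP; case: (GE x).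
rewrite /Rintegral (@continuous_FTC2 _ _ G) //.
- rewrite /= /G -sumrB mulr_sumr [RHS]big_mkcond /=.
  apply: eq_bigr => i _; rewrite /g; case: ifP => [/eqP|] uv.
    by rewrite /GRing.scale /=; ring.
  rewrite mulr0 sin0 mulrBl sinB !sin_natr_2pi /GRing.scale /=; ring.
- apply: continuous_subspaceT.
  apply: continuous_big => [|i _ x]; first exact: add_continuous.
  apply: continuousM; first exact: cst_continuous.
  apply: (@continuous_comp _ _ _ (fun t : R => w i * t) cos) => //=.
    by apply: continuousM; [exact: cst_continuous|exact: cvg_id].
  exact: continuous_cos.
- split=> [x _||]; first by case: (GE x).
    by apply: cvg_at_right_filter; exact: Gc.
  by apply: cvg_at_left_filter; exact: Gc.
- by move=> x _; rewrite derive1E; case: (GE x).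
Qed.

(** * The fourth power of the norm as a sum over additive quadruples *)

Definition re_coef {R : realType} (g : {poly R[i]}) (j : nat) : R := complex.Re g`_j.

Lemma expiD (R : realType) (s t : R) : expi (s + t) = expi s * expi t.
Proof. by apply/eqP; rewrite eq_complex /expi /= cosD sinD addrC [X in _ && (X == _)]addrC !eqxx. Qed.

Lemma expiX (R : realType) (t : R) (j : nat) : expi t ^+ j = expi (j%:R * t).
Proof.
elim: j => [|j IH]; first by rewrite mul0r expr0 /expi cos0 sin0.
by rewrite exprS IH -expiD -nat1r mulrDl mul1r.
Qed.

Lemma conjc_expi (R : realType) (t : R) : (expi t)^*%C = expi (- t).
Proof. by rewrite /expi /= cosN sinN. Qed.

Lemma normc_sqr (R : realType) (z : R[i]) :
  ((ComplexField.Normc.normc z ^+ 2)%:C)%C = z * (z^*)%C.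
Proof.
case: z => x y; rewrite /= sqr_sqrtr ?addr_ge0 ?sqr_ge0 //.
by apply/eqP; rewrite eq_complex /=; apply/andP; split; apply/eqP; ring.
Qed.

Lemma Re_sum (R : rcfType) (I : Type) (r : seq I) (F : I -> R[i]) :
  complex.Re (\sum_(i <- r) F i) = \sum_(i <- r) complex.Re (F i).
Proof. by apply: (big_morph _ _ (erefl _)); case=> ? ? []. Qed.

Lemma normc_littlewood_pow4 (R : realType) (n : nat) (g : {poly R[i]}) (t : R) :
  littlewood n g ->
  ComplexField.Normc.normc g.[expi t] `^ 4 =
  \sum_(i : ('I_n * 'I_n) * ('I_n * 'I_n))
    re_coef g i.1.1 * re_coef g i.1.2 * (re_coef g i.2.1 * re_coef g i.2.2) *
    cos (((i.1.1 + i.1.2)%N%:R - (i.2.1 + i.2.2)%N%:R) * t).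
Proof.
move=> [sg hg].
have aE (j : 'I_n) : g`_j = (re_coef g j)%:C%C.
  by rewrite /re_coef; case: (hg j (ltn_ord j)) => ->; rewrite ?raddfN.
set z := g.[expi t].
have zE : z = \sum_(j < n) (re_coef g j)%:C%C * expi (j%:R * t).
  rewrite /z horner_coef sg; apply: eq_bigr => j _.
  by rewrite aE expiX.
(* The signs are real, so conjugation only negates the angles. *)
have zbarE : (z^*)%C = \sum_(j < n) (re_coef g j)%:C%C * expi (- (j%:R * t)).
  rewrite zE rmorph_sum; apply: eq_bigr => j _.
  by rewrite rmorphM -conjc_expi -[in RHS]conjc_real.
rewrite powR_mulrn ?/ComplexField.Normc.normc; last first.
  by case: (z) => x y; rewrite sqrtr_ge0.
(* Both factors [z] supply [j] and [k], both conjugates supply [l] and [m]; taking the real part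
   turns each exponential into a cosine. *)
have -> : ComplexField.Normc.normc z ^+ 4 = complex.Re ((z * z) * ((z^*)%C * (z^*)%C)).
  have -> : z * z * (z^*%C * z^*%C) = (z * z^*%C) ^+ 2 by ring.
  by rewrite -normc_sqr -rmorphXn /= -exprM.
rewrite zbarE zE 2!big_distrlr /= !pair_big /= big_distrlr /= pair_big /= Re_sum.
apply: eq_bigr => -[[j k] [l m]] _ /=.
have -> : ((j + k)%N%:R - (l + m)%N%:R) * t =
  (j%:R * t + k%:R * t) + (- (l%:R * t) + - (m%:R * t)) :> R.
  by rewrite !natrD; ring.
rewrite [cos (_ + _ + _)]cosD !cosD !sinD; ring.
Qed.

Lemma polynorm4_littlewood (R : realType) (n : nat) (g : {poly R[i]}) :
  littlewood n g ->
  polynorm 4 g ^+ 4 =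
  \sum_(j < n) \sum_(k < n) \sum_(l < n) \sum_(m < n | (j + k == l + m)%N)
    re_coef g j * re_coef g k * (re_coef g l * re_coef g m).
Proof.
move=> hg; rewrite /polynorm.
set J := (X in X `^ _).
(* Nonnegativity of the mean value lets the exponent [4^-1] in [polynorm] cancel against the fourth
   power. *)
have J0 : 0 <= J.
  rewrite mulr_ge0 ?invr_ge0 ?mulr_ge0 ?pi_ge0 //.
  by apply: Rintegral_ge0 => t _; exact: powR_ge0.
rewrite -powR_mulrn ?powR_ge0 // -powRrM mulVf ?pnatr_eq0 // powRr1 // /J.
under eq_Rintegral do rewrite (normc_littlewood_pow4 _ _ _ _ hg).
rewrite Rintegral_trig_sum mulrA mulVf ?mul1r; last first.
  by rewrite mulf_neq0 ?lt0r_neq0 ?pi_gt0 // pnatr_eq0.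
rewrite pair_big /= big_mkcond /= [in RHS](eq_bigr (fun p : 'I_n * 'I_n =>
  \sum_(q : 'I_n * 'I_n) if (p.1 + p.2 == q.1 + q.2)%N then
    re_coef g p.1 * re_coef g p.2 * (re_coef g q.1 * re_coef g q.2) else 0)) ?pair_big //.
move=> [j k] _ /=; rewrite -(pair_big xpredT xpredT (fun l m : 'I_n =>
  if (j + k == l + m)%N then re_coef g j * re_coef g k * (re_coef g l * re_coef g m) else 0)).
by apply: eq_bigr => l _; rewrite big_mkcond.
Qed.

(** * Reduction of the quadruple sum to distinct monomials in the signs *)

Lemma sum_sym_ord (R : pzRingType) (n : nat) (G : 'I_n -> 'I_n -> R) :
  (forall i j, G i j = G j i) ->
  \sum_i \sum_j G i j = \sum_i G i i + 2 * \sum_(i < n) \sum_(j < n | (i < j)%N) G i j.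
Proof.
move=> Gsym.
have -> : \sum_i \sum_j G i j =
    \sum_(i < n) (G i i + (\sum_(j < n | (i < j)%N) G i j + \sum_(j < n | (j < i)%N) G i j)).
  apply: eq_bigr => i _; rewrite (bigD1 i) //=; congr (_ + _).
  rewrite (bigID (fun j : 'I_n => (i < j)%N)) /=; congr (_ + _);
    apply: eq_bigl => j; rewrite -val_eqE /=; lia.
rewrite !big_split /=; congr (_ + _).
rewrite mulr_natl mulr2n; congr (_ + _).
rewrite (exchange_big_dep xpredT) //=.
by apply: eq_bigr => i _; apply: eq_bigr => j _; exact: Gsym.
Qed.

(** When the middle indices coincide, their signs multiply to 1 and only the outer factors
    remain. *)
Definition walsh_index (p q r s : nat) : seq nat :=
  if q == r then [:: p; s] else [:: p; q; r; s].

(* A triple (p, q, s) stands for the quadruple p < q <= r < s with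
   r = p + s - q; then q <= r means 2q <= p + s, which with p < q also
   forces r < s. *)
Definition walsh_dom (n : nat) : pred ('I_n * 'I_n * 'I_n) :=
  fun i => (i.1.1 < i.1.2)%N && (i.1.2 + i.1.2 <= i.1.1 + i.2)%N.

(** The truncated subtraction is exact on [walsh_dom], where q is at most p + s. *)
Definition walsh_seq (n : nat) (i : 'I_n * 'I_n * 'I_n) : seq nat :=
  walsh_index i.1.1 i.1.2 (i.1.1 + i.2 - i.1.2) i.2.

(** These are multiplicities. Exchanging p and s, exchanging q and r, and exchanging the two sides
    of p + s = q + r give 8 ordered quadruples; for q = r the second exchange is trivial, which
    leaves 4. *)
Definition walsh_coef (R : pzRingType) (n : nat) (i : 'I_n * 'I_n * 'I_n) : R :=
  if (i.1.2 + i.1.2 == i.1.1 + i.2)%N then 4 else 8.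

Lemma big_walsh_dom (R : nmodType) (n : nat) (F : 'I_n * 'I_n * 'I_n -> R) :
  \sum_(i | walsh_dom n i) F i =
  \sum_(p < n) \sum_(q < n | (p < q)%N) \sum_(s < n | (q + q <= p + s)%N) F (p, q, s).
Proof.
rewrite [RHS](eq_bigr (fun p : 'I_n => \sum_(qs : 'I_n * 'I_n |
    (p < qs.1)%N && (qs.1 + qs.1 <= p + qs.2)%N) F (p, qs.1, qs.2))); last first.
  by move=> p _; rewrite pair_big_dep.
rewrite pair_big_dep /=.
rewrite (reindex (fun x : 'I_n * ('I_n * 'I_n) => (x.1, x.2.1, x.2.2))) /=; last first.
  by exists (fun x : 'I_n * 'I_n * 'I_n => (x.1.1, (x.1.2, x.2))) => [[p [q s]]|[[p q] s]].
by [].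
Qed.

Lemma sum_ord_pairs (R : pzRingType) (n : nat) :
  2 * \sum_(i < n) \sum_(j < n | (i < j)%N) 1 = n%:R * (n%:R - 1) :> R.
Proof.
have := @sum_sym_ord R n (fun _ _ => 1) (fun _ _ => erefl).
rewrite !sumr_const !card_ord -mulrnA natrM => e.
by rewrite mulrBr mulr1 e addrC addKr.
Qed.

(** The symmetries exchanging l with m, j with k, and the two sides of the equation are removed in
    turn by three uses of [sum_sym_ord]. Each use splits off a diagonal, which feeds either the
    constant or the two-index monomials. *)
Lemma sum_additive_quadruples (R : comPzRingType) (n : nat) (a : nat -> R) :
  (forall j, (j < n)%N -> a j * a j = 1) ->
  \sum_(j < n) \sum_(k < n) \sum_(l < n) \sum_(m < n | (j + k == l + m)%N)
    a j * a k * (a l * a m) =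
  2 * n%:R ^+ 2 - n%:R +
  \sum_(i | walsh_dom n i) walsh_coef R n i * \prod_(j <- walsh_seq n i) a j.
Proof.
move=> a2.
have aa (j : 'I_n) : a j * a j = 1 by exact: a2.
pose H (j k : 'I_n) : R := \sum_(l < n) \sum_(m < n | (j + k == l + m)%N)
    a j * a k * (a l * a m).
(* For fixed [j] and [k], [h] is the part with l = m and [Z] the part with l < m. *)
pose h (j k : 'I_n) : R := \sum_(l < n) if (j + k == l + l)%N then a j * a k else 0.
pose Z (j k : 'I_n) : R := \sum_(l < n) \sum_(m < n | (l < m)%N)
  if (j + k == l + m)%N then a j * a k * (a l * a m) else 0.
have HE j k : H j k = h j k + 2 * Z j k.
  rewrite /H; under eq_bigr do rewrite big_mkcond /=.
  rewrite (@sum_sym_ord R n (fun l m : 'I_n =>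
    if (j + k == l + m)%N then a j * a k * (a l * a m) else 0)).
    congr (_ + _); apply: eq_bigr => l _; by rewrite aa mulr1.
  by move=> l m; rewrite [(l + m)%N]addnC [a l * _]mulrC.
have Hsym j k : H j k = H k j.
  by apply: eq_bigr => l _; rewrite [(j + k)%N]addnC [a j * _]mulrC.
under eq_bigr => j _ do under eq_bigr => k _ do rewrite -/(H j k).
rewrite (@sum_sym_ord R n H Hsym).
pose Y := \sum_(j < n) \sum_(k < n | (j < k)%N) h j k.
have diagE : \sum_i H i i = n%:R + 2 * Y.
  rewrite (eq_bigr (fun i => 1 + 2 * Z i i)) => [|i _]; last first.
    rewrite HE /h (bigD1 i) //= eqxx aa big1 ?addr0 // => l li.
    by case: eqP => // e; move: li; rewrite -val_eqE /=; lia.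
  rewrite big_split /= sumr_const card_ord -mulr_sumr; suff -> : \sum_i Z i i = Y by [].
  rewrite /Y exchange_big; apply: eq_bigr => l _.
  rewrite exchange_big; apply: eq_bigr => m _.
  by apply: eq_bigr => i _; rewrite aa mul1r eq_sym.
have offdiagE : \sum_(i < n) \sum_(j < n | (i < j)%N) H i j =
   Y + 2 * \sum_(i < n) \sum_(j < n | (i < j)%N) Z i j.
  rewrite /Y mulr_sumr -big_split /=; apply: eq_bigr => i _.
  by rewrite mulr_sumr -big_split /=; apply: eq_bigr => j _; exact: HE.
(* [K] fixes the smaller index on each side. If j = l then k = m and every term is 1; if j < l then
   the indices are ordered j < l < m < k. *)
pose K (j l : 'I_n) : R := \sum_(k < n | (j < k)%N) \sum_(m < n | (l < m)%N)
  if (j + k == l + m)%N then a j * a k * (a l * a m) else 0.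
have ZK : \sum_(i < n) \sum_(j < n | (i < j)%N) Z i j = \sum_j \sum_l K j l.
  apply: eq_bigr => j _; rewrite /Z exchange_big /=; apply: eq_bigr => l _.
  by [].
have Ksym j l : K j l = K l j.
  rewrite /K exchange_big /=; apply: eq_bigr => k _; apply: eq_bigr => m _.
  by rewrite eq_sym mulrC.
have Kdiag j : K j j = \sum_(k < n | (j < k)%N) 1.
  apply: eq_bigr => k jk; rewrite (bigD1 k) //= eqxx big1 ?addr0 => [|m /andP[_ mk]].
    by rewrite mulrACA aa mul1r aa.
  by rewrite eqn_add2l; case: eqP => // /val_inj e; rewrite e eqxx in mk.
pose M (p q s : 'I_n) := a p * a q * (a (p + s - q)%N * a s).
have Koff (j l : 'I_n) : (j < l)%N -> K j l = \sum_(k < n | (l + l < j + k)%N) M j l k.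
  move=> jl; rewrite /K (bigID (fun k : 'I_n => (l + l < j + k)%N)) /=.
  rewrite [X in _ + X]big1 ?addr0 => [|k /andP[jk lk]]; last first.
    by apply: big1 => m lm; case: eqP => // e; exfalso; lia.
  apply: eq_big => [k|k /andP[jk lk]]; first by apply/andP/idP; lia.
  (* The fourth index m = j + k - l lies below k because j < l, so it is in range. *)
  have mn : (j + k - l < n)%N by have := ltn_ord k; lia.
  rewrite (bigD1 (Ordinal mn)) /=; last by lia.
  rewrite big1 ?addr0 => [|m /andP[lm mk]].
    by rewrite ifT ?/M; [ring|lia].
  by case: eqP => // e; move: mk; rewrite -val_eqE /=; lia.
(* [Y] collects the terms a_p a_s with p + s even; it arises once from j = k and
   once from l = m. *)
rewrite diagE offdiagE ZK (@sum_sym_ord R n K Ksym).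
rewrite (eq_bigr _ (fun j _ => Kdiag j)).
rewrite big_walsh_dom.
rewrite [X in _ = _ + X](eq_bigr (fun p : 'I_n => \sum_(q < n | (p < q)%N)
   (8 * K p q + 4 * \sum_(s < n | (q + q == p + s)%N) a p * a s))).
  have YE : Y = \sum_(p < n) \sum_(q < n | (p < q)%N)
      \sum_(s < n | (q + q == p + s)%N) a p * a s.
    apply: eq_bigr => p _; rewrite /h exchange_big [RHS]big_mkcond /=.
    apply: eq_bigr => q _; rewrite -big_mkcondr /=; case: ltnP => pq.
      by apply: eq_bigl => s; rewrite [LHS]andbC eq_sym; case: eqP => //= e; lia.
    by rewrite big_pred0 // => s; apply/andP => -[ps /eqP e]; lia.
  have -> : \sum_(p < n) \sum_(q < n | (p < q)%N)
      (8 * K p q + 4 * \sum_(s < n | (q + q == p + s)%N) a p * a s) =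
      8 * (\sum_(p < n) \sum_(q < n | (p < q)%N) K p q) + 4 * Y.
    rewrite YE !mulr_sumr -big_split /=; apply: eq_bigr => p _.
    by rewrite !mulr_sumr -big_split.
  (* The constant is n, from j = k = l = m, plus 4 for each of the [N] pairs of distinct indices. *)
  have := @sum_ord_pairs R n; set N := \sum_(i < n) _ => NE.
  have -> : 2 * n%:R ^+ 2 - n%:R = n%:R + 2 * (2 * N) :> R by rewrite NE; ring.
  ring.
(* Strict inequality q + q < p + s yields the four-index monomials in [K]; equality yields the
   two-index ones. *)
move=> p _; apply: eq_bigr => q pq; rewrite Koff // !mulr_sumr.
rewrite (bigID (fun s : 'I_n => (q + q < p + s)%N)) /=; congr (_ + _).
  apply: eq_big => [s|s /andP[_ qs]]; first by apply/andP/idP; lia.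
  rewrite /walsh_coef /walsh_seq /walsh_index /= !ifF ?big_cons ?big_nil /M; [|lia|lia].
  by rewrite mulr1 !mulrA.
apply: eq_big => [s|s /andP[qs1 qs2]]; first by apply/andP/eqP; lia.
rewrite /walsh_coef /walsh_seq /walsh_index /= !ifT ?big_cons ?big_nil; [|lia|lia].
by rewrite mulr1 !mulrA.
Qed.

(** * The sum of the squared coefficients in closed form *)

Lemma sum_walsh_coef_sqr_fixed_ends (R : comPzRingType) (n p s : nat) :
  (p < s)%N -> (s < n)%N ->
  \sum_(q < n | (p < q)%N && (q + q <= p + s)%N)
     (if (q + q == p + s)%N then 16 else 64) =
  32 * (s - p)%N%:R - 40 - 8 * (-1) ^+ (s - p) :> R.
Proof.
move=> ps sn.
(* [e] is the largest admissible [q], so there are e - p terms, each 64 except that for p + s even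
   the midpoint q = e gives 16. This loss of 48 is the source of the parity term. *)
set e := ((p + s)./2)%N.
have := odd_double_half (p + s); rewrite -/e -addnn; set b := odd _ => be.
have pe : (p <= e)%N by case: b be => /=; lia.
have en : (e < n)%N by case: b be => /=; lia.
transitivity (\sum_(p.+1 <= q < e.+1) (64 - (if (q + q == p + s)%N then 48 else 0)) : R).
  rewrite big_geq_mkord /= (big_ord_widen_cond n (fun q => p < q)%N
    (fun q => 64 - (if (q + q == p + s)%N then 48 else 0) : R)) //.
  apply: eq_big => [q|q _]; first by case: b be => /= ?; apply/andP/andP; lia.
  by case: ifP => _; ring.
have sE : (s - p = (e - p).*2 + b)%N by rewrite -addnn; case: b be => /=; lia.
rewrite sumrB sumr_const_nat subSS sE exprD -mul2n exprM sqrrN !expr1n mul1r.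
rewrite natrD natrM.
case: b be {sE} => /= be.
  rewrite big1_seq => [|q _]; last by rewrite ifF //; lia.
  rewrite expr1 -mulr_natr; ring.
rewrite big_nat_recr /=; last by lia.
rewrite ifT; last by lia.
rewrite big_nat_cond big1 => [|q /andP[/andP[_ qe] _]]; last by rewrite ifF //; lia.
rewrite expr0 -mulr_natr; ring.
Qed.

Lemma sum_walsh_coef_sqr (R : comPzRingType) (n : nat) :
  \sum_(i | walsh_dom n i) walsh_coef R n i ^+ 2 =
  \sum_(s < n) \sum_(p < s) (32 * (s - p)%N%:R - 40 - 8 * (-1) ^+ (s - p)).
Proof.
rewrite big_walsh_dom.
under eq_bigr => p _.
  under eq_bigr => q _.
    under eq_bigr => s _ do rewrite /walsh_coef /=.
    over.
  rewrite (exchange_big_dep xpredT) //=.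
  over.
rewrite exchange_big /=; apply: eq_bigr => s _.
rewrite (big_ord_widen n (fun p => 32 * (s - p)%N%:R - 40 - 8 * (-1) ^+ (s - p)) (ltnW (ltn_ord s))).
rewrite [RHS]big_mkcond; apply: eq_bigr => p _; case: ltnP => ps.
  rewrite -(@sum_walsh_coef_sqr_fixed_ends R n) //; apply: eq_bigr => q _.
  by case: ifP => _; ring.
(* The conditions p < q and q + q <= p + s already force p < s. *)
by apply: big1 => q /andP[pq qs]; exfalso; lia.
Qed.

Lemma variance_closed_form (R : numFieldType) (n : nat) :
  \sum_(s < n) \sum_(p < s) (32 * (s - p)%N%:R - 40 - 8 * (-1) ^+ (s - p)) =
  16 / 3 * n%:R ^+ 3 - 20 * n%:R ^+ 2 + 56 / 3 * n%:R - 2 + 2 * (-1) ^+ n :> R.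
Proof.
have inner (s : nat) :
    \sum_(p < s) (32 * (s - p)%N%:R - 40 - 8 * (-1) ^+ (s - p)) =
    16 * s%:R ^+ 2 - 24 * s%:R + 4 - 4 * (-1) ^+ s :> R.
  elim: s => [|s IH]; first by rewrite big_ord0 expr0; ring.
  (* The summand depends only on s - p, so removing the term p = 0 leaves the inner sum for the
     previous [s]. *)
  rewrite big_ord_recl /= subn0.
  under eq_bigr do rewrite /bump /= add1n subSS.
  by rewrite IH -natr1 exprS; ring.
elim: n => [|n IH]; first by rewrite big_ord0 expr0; field.
by rewrite big_ord_recr /= IH inner -[n.+1%:R]natr1 [(-1) ^+ n.+1]exprS; field.
Qed.

(** * Littlewood polynomials as a finite sample space, and Walsh orthogonality *)

Lemma coef_sqr (R : realType) (n : nat) (g : {poly R[i]}) (j : nat) :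
  littlewood n g -> (j < n)%N -> re_coef g j * re_coef g j = 1.
Proof.
move=> [_ hg] /hg; rewrite /re_coef => -[] -> /=; by rewrite ?mulrNN mulr1.
Qed.

Lemma finite_littlewood (R : realType) (n : nat) : finite_set (@littlewood R n).
Proof.
pose h (b : {ffun 'I_n -> bool}) : {poly R[i]} :=
  \poly_(j < n) (if insub j is Some k then (-1) ^+ b k else 0).
apply: (@sub_finite_set _ _ (range h)); last exact: finite_image.
move=> g [sg hg]; exists [ffun k : 'I_n => g`_k == -1] => //.
apply/polyP => j; rewrite coef_poly; case: ltnP => jn; last first.
  by rewrite nth_default // sg.
rewrite insubT /= ffunE /=.
have N11 : (1 == -1 :> R[i]) = false.
  by rewrite -addr_eq0 -[1 + 1]/(2%:R) pnatr_eq0.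
by case: (hg j jn) => ->; rewrite ?N11 ?eqxx.
Qed.

Lemma littlewood_poly (R : realType) (n : nat) (c : nat -> R[i]) : (0 < n)%N ->
  (forall j, (j < n)%N -> c j = 1 \/ c j = -1) ->
  littlewood n (\poly_(j < n) c j).
Proof.
move=> n0 hc; split=> [|j jn]; last by rewrite coef_poly jn; exact: hc.
apply: size_poly_eq; have [|->|->] := hc n.-1; first by rewrite prednK.
  exact: oner_neq0.
by rewrite oppr_eq0 oner_neq0.
Qed.

Lemma card_littlewood_gt0 (R : realType) (n : nat) : (0 < n)%N ->
  (0 < #|` fset_set (@littlewood R n)|)%N.
Proof.
move=> n0; rewrite cardfs_gt0; apply/fset0Pn; exists (\poly_(j < n) 1).
rewrite in_fset_set ?inE; last exact: finite_littlewood.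
by apply: littlewood_poly => // j _; left.
Qed.

(** Negating one coefficient is the symmetry of the sample space behind the orthogonality of the
    characters. *)
Definition flip {R : realType} (n i : nat) (g : {poly R[i]}) : {poly R[i]} :=
  \poly_(j < n) ((-1) ^+ (j == i) * g`_j).

Lemma littlewood_flip (R : realType) (n i : nat) (g : {poly R[i]}) : (0 < n)%N ->
  littlewood n g -> littlewood n (flip n i g).
Proof.
move=> n0 [_ hg]; apply: littlewood_poly => // j /hg.
by case: (j == i) => -[] ->; rewrite ?expr0 ?expr1 ?mul1r ?mulrNN ?mulr1; [right|left|left|right].
Qed.

Lemma flipK (R : realType) (n i : nat) (g : {poly R[i]}) :
  littlewood n g -> flip n i (flip n i g) = g.
Proof.
move=> [sg _]; apply/polyP => j; rewrite !coef_poly; case: ltnP => jn.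
  by rewrite mulrA -expr2 sqrr_sign mul1r.
by rewrite nth_default // sg.
Qed.

Lemma coef_flip (R : realType) (n i : nat) (g : {poly R[i]}) (j : nat) :
  (j < n)%N -> re_coef (flip n i g) j = (-1) ^+ (j == i) * re_coef g j.
Proof.
move=> jn; rewrite /re_coef coef_poly jn.
by case: (j == i); rewrite ?expr0 ?expr1 ?mul1r ?mulN1r ?raddfN.
Qed.

Definition walsh {R : realType} (s : seq nat) (g : {poly R[i]}) : R :=
  \prod_(j <- s) re_coef g j.

Lemma walsh_flip (R : realType) (n i : nat) (g : {poly R[i]}) (s : seq nat) :
  uniq s -> all (fun j => j < n)%N s ->
  walsh s (flip n i g) = (-1) ^+ (i \in s) * walsh s g.
Proof.
rewrite /walsh; elim: s => [|j s IH] /=; first by rewrite !big_nil mulr1.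
move=> /andP[js us] /andP[jn sn]; rewrite !big_cons IH // coef_flip //.
rewrite mulrACA -signr_addb in_cons [i == j]eq_sym; congr (_ ^+ _ * _).
by case: eqP => // <-; rewrite (negbTE js).
Qed.

(** An involution that preserves a finite set permutes it. *)
Lemma sum_flip (R : realType) (n i : nat) (F : {poly R[i]} -> R) : (0 < n)%N ->
  \sum_(g <- fset_set (littlewood n)) F (flip n i g) =
  \sum_(g <- fset_set (littlewood n)) F g.
Proof.
move=> n0; have finA := @finite_littlewood R n.
have memA (g : {poly R[i]}) : (g \in fset_set (littlewood n)) = (g \in littlewood n).
  exact: in_fset_set.
rewrite -(big_map (flip n i) xpredT F).
have flip_inj : {in fset_set (littlewood n) &, injective (flip (R := R) n i)}.
  by move=> g h; rewrite !memA !inE => /(flipK _ _ i) gK /(flipK _ _ i) hK e; rewrite -gK -hK e.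
apply: perm_big; apply: uniq_perm; rewrite ?map_inj_in_uniq ?fset_uniq //.
move=> g; apply/mapP/idP => [[h hA ->]|gA].
  by move: hA; rewrite !memA !inE; exact: littlewood_flip.
move: (gA); rewrite memA inE => gL; exists (flip n i g); last by rewrite flipK.
by rewrite memA inE; exact: littlewood_flip.
Qed.

(** Sorted lists that differ also differ as sets, so some index lies in exactly one of them. For
    equal lists every term is a product of squared signs, hence 1. *)
Lemma walsh_orthogonal (R : realType) (n : nat) (s t : seq nat) : (0 < n)%N ->
  sorted ltn s -> sorted ltn t ->
  all (fun j => j < n)%N s -> all (fun j => j < n)%N t ->
  \sum_(g <- fset_set (@littlewood R n)) walsh s g * walsh t g =
  if s == t then #|` fset_set (@littlewood R n)|%:R else 0.
Proof.
move=> n0 ss st sn tn; have finA := @finite_littlewood R n.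
have us : uniq s by apply: sorted_uniq ss; [exact: ltn_trans|exact: ltnn].
have ut : uniq t by apply: sorted_uniq st; [exact: ltn_trans|exact: ltnn].
case: eqP => [<-|nst].
  rewrite (eq_big_seq (fun=> 1)) => [|g].
    by rewrite big_const_seq count_predT iter_addr addr0.
  rewrite in_fset_set // inE => gA.
  rewrite /walsh -big_split /= big_seq big1 // => j /(allP sn) jn.
  exact: (coef_sqr _ n).
have [i ist] : exists i, (i \in s) != (i \in t).
  apply/not_existsP => h; apply: nst.
  apply: (@irr_sorted_eq _ ltn ltn_trans ltnn s t) => // i.
  by apply/eqP; apply: contrapT => /negP /h.
set S := \sum_(g <- _) _.
(* Flipping the sign of a_i negates the product of the two characters. *)
suff : S = - S by lra.
rewrite -{1}[S](@sum_flip R n i) // -sumrN; apply: eq_bigr => g _.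
rewrite !walsh_flip // mulrACA -signr_addb.
by rewrite -negb_eqb ist expr1 mulN1r.
Qed.

(** * Expectations under the uniform law as finite averages *)

Lemma expectation_uniform_on (R : realType) (d : measure_display)
    (T : measurableType d) (P : probability T R) (X : choiceType) (A : set X)
    (f : T -> X) (G : X -> R) :
  finite_set A -> uniform_on P A f ->
  'E_P[G \o f]%E = (#|` fset_set A|%:R^-1 * \sum_(g <- fset_set A) G g)%:E.
Proof.
move=> finA [Af fU].
have Gf w : (G (f w))%:E = (\sum_(g <- fset_set A) (G g)%:E * (\1_(f @^-1` [set g]) w)%:E)%E.
  have fwA : f w \in fset_set A by rewrite in_fset_set // inE.
  rewrite (bigD1_seq (f w)) //= ?fset_uniq // indicE mem_set //= mule1.
  rewrite big1 ?adde0 // => g gw; rewrite indicE (_ : _ \in _ = false) ?mule0 //.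
  by apply/negbTE; rewrite notin_setE /= => e; rewrite -e eqxx in gw.
rewrite unlock; rewrite (eq_integral _ _ (fun w _ => Gf w)).
(* Outside [A] the summand is set to 0: [integral_sum] asks for integrability at every [g], while
   fibres are known to be measurable only over [A]. *)
pose F g w : \bar R := if g \in A then ((G g)%:E * (\1_(f @^-1` [set g]) w)%:E)%E else 0%E.
have finI g : A g -> P.-integrable setT (EFin \o \1_(f @^-1` [set g])).
  move=> /fU[mg _]; exact: integrable_indic.
transitivity (\int[P]_w \sum_(g <- fset_set A) F g w)%E.
  apply: eq_integral => w _; apply: eq_big_seq => g.
  by rewrite in_fset_set // /F => ->.
rewrite integral_sum //; last first.
  move=> g; rewrite /F; case gA: (g \in A); last exact: integrable0.
  by apply: integrableZl => //; exact: finI (set_mem gA).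
rewrite mulr_sumr -sumEFin; apply: eq_big_seq => g; rewrite in_fset_set // /F => gA.
rewrite gA integralZl //; last by exact: finI (set_mem gA).
have [mg Pg] := fU g (set_mem gA).
by rewrite integral_indic // setIT [X in (_ * X)%E]Pg -EFinM mulrC.
Qed.

(** * Index lists of the monomials *)

Lemma walsh_seq_sorted (n : nat) (i : 'I_n * 'I_n * 'I_n) :
  walsh_dom n i -> sorted ltn (walsh_seq n i).
Proof.
case: i => [[p q] s] /andP[/= pq qs]; rewrite /walsh_seq /walsh_index /=.
by case: eqP => e /=; rewrite ?andbT; [lia|apply/and3P; split; lia].
Qed.

Lemma walsh_seq_lt (n : nat) (i : 'I_n * 'I_n * 'I_n) :
  walsh_dom n i -> all (fun j => j < n)%N (walsh_seq n i).
Proof.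
case: i => [[p q] s] /andP[/= pq qs]; rewrite /walsh_seq /walsh_index /=.
have := ltn_ord p; have := ltn_ord q; have := ltn_ord s.
by case: eqP => e /=; rewrite ?andbT => ? ? ?; [apply/andP|apply/and4P]; split; lia.
Qed.

(** The ends of the list give p and s. A four-element list shows q directly; for a two-element list
    q is the midpoint of p and s. *)
Lemma walsh_seq_inj (n : nat) :
  {in walsh_dom n &, injective (walsh_seq n)}.
Proof.
move=> [[p q] s] [[p' q'] s'] /andP[/= pq qs] /andP[/= pq' qs'].
rewrite /walsh_seq /walsh_index /=.
suff h : (p : nat) = p' -> (s : nat) = s' -> (q : nat) = q' -> (p, q, s) = (p', q', s').
  by case: eqP => e; case: eqP => e' //= [] *; apply: h => //; lia.
by move=> /val_inj -> /val_inj -> /val_inj ->.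
Qed.

Lemma walsh_seq_neq_nil (n : nat) (i : 'I_n * 'I_n * 'I_n) :
  (walsh_seq n i == [::]) = false.
Proof. by rewrite /walsh_seq /walsh_index; case: ifP. Qed.

(** * Mean and variance from orthogonality *)

Theorem theorem1 (R : realType) (n : nat) (hn : (1 < n)%N)
    (d : measure_display) (T : measurableType d) (P : probability T R)
    (f : T -> {poly R[i]}) (hf : uniform_on P (littlewood n) f) :
  'E_P[fun w => (polynorm 4 (f w) ^+ 4)%R]%E = (2 * n%:R ^+ 2 - n%:R)%:E /\
  'V_P[fun w => (polynorm 4 (f w) ^+ 4)%R]%E =
    (16 / 3 * n%:R ^+ 3 - 20 * n%:R ^+ 2 + 56 / 3 * n%:R - 2
       + 2 * (-1) ^+ n)%:E.
Proof.
have n0 : (0 < n)%N by exact: ltnW.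
have finA := @finite_littlewood R n.
set m : R := 2 * n%:R ^+ 2 - n%:R.
pose A := fset_set (@littlewood R n).
have cardA : #|` A|%:R != 0 :> R by rewrite pnatr_eq0 -lt0n card_littlewood_gt0.
pose c : 'I_n * 'I_n * 'I_n -> R := walsh_coef R n.
pose chi i : {poly R[i]} -> R := walsh (walsh_seq n i).
pose S g : R := \sum_(i | walsh_dom n i) c i * chi i g.
have normE g : littlewood n g -> polynorm 4 g ^+ 4 = m + S g.
  move=> gA; rewrite (polynorm4_littlewood _ _ _ gA).
  by rewrite sum_additive_quadruples // => j; exact: coef_sqr.
(* The empty list gives the constant character 1, so a vanishing mean is orthogonality to it. *)
have chi0 i : walsh_dom n i -> \sum_(g <- A) chi i g = 0.
  move=> di; have := @walsh_orthogonal R n (walsh_seq n i) [::] n0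
    (walsh_seq_sorted _ _ di) isT (walsh_seq_lt _ _ di) isT.
  rewrite walsh_seq_neq_nil => e; rewrite -[RHS]e; apply: eq_bigr => g _.
  by rewrite [X in _ * X]big_nil mulr1.
have chi_orth i j : walsh_dom n i -> walsh_dom n j ->
    \sum_(g <- A) chi i g * chi j g = if i == j then #|` A|%:R else 0.
  move=> di dj; rewrite walsh_orthogonal ?walsh_seq_sorted ?walsh_seq_lt //.
  by rewrite (inj_in_eq (walsh_seq_inj n)).
have S0 : \sum_(g <- A) S g = 0.
  rewrite exchange_big big1 // => i di; rewrite -mulr_sumr chi0 ?mulr0 //.
(* Parseval's identity: after expanding the square, only the diagonal terms survive. *)
have S2 : \sum_(g <- A) S g ^+ 2 =
    #|` A|%:R * \sum_(i | walsh_dom n i) c i ^+ 2.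
  under eq_bigr do rewrite expr2 big_distrlr /=.
  rewrite exchange_big mulr_sumr; apply: eq_bigr => i di.
  rewrite exchange_big /= (bigD1 i) //= [X in _ + X]big1 ?addr0 => [|j /andP[dj ji]].
    under eq_bigr do rewrite mulrACA.
    by rewrite -mulr_sumr chi_orth // eqxx mulrC expr2.
  under eq_bigr do rewrite mulrACA.
  by rewrite -mulr_sumr chi_orth // eq_sym (negbTE ji) mulr0.
have EE (G : {poly R[i]} -> R) :
  'E_P[G \o f]%E = (#|` A|%:R^-1 * \sum_(g <- A) G g)%:E.
  exact: expectation_uniform_on.
have mean : 'E_P[fun w => (polynorm 4 (f w) ^+ 4)%R]%E = m%:E.
  rewrite (EE (fun g => polynorm 4 g ^+ 4)) (eq_big_seq (fun g => m + S g)) => [|g]; last first.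
    by rewrite in_fset_set // inE => /normE.
  rewrite big_split /= S0 addr0 big_const_seq count_predT iter_addr addr0.
  by rewrite -[m *+ _]mulr_natl mulKf.
split=> //.
(* Once the mean [m] is subtracted, the variance is the average of [S g ^+ 2]. *)
rewrite /variance covariance.unlock mean.
rewrite (EE (fun g => (polynorm 4 g ^+ 4 - m) * (polynorm 4 g ^+ 4 - m))).
rewrite (eq_big_seq (fun g => S g ^+ 2)) => [|g]; last first.
  by rewrite in_fset_set // inE => /normE ->; rewrite addrC addKr expr2.
by rewrite S2 mulKf // /c sum_walsh_coef_sqr variance_closed_form.
Qed.
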